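(* Let $X=(X,d,\mu)$ be a Borel and Borel-regular metric measure space all of whose closed balls have positive and finite measure, and let $r\in(0,\infty)$. Suppose that $X$ is $s$-doubling for all $s>0$ and satisfies the property $(\ast)_r$. Then the averaging operator $A_r : L^\infty(X)\to L^\infty(X)$ is compact if and only if $X$ is bounded.
   Context: $(X,d)$ is a metric space and $\mu$ is a measure on $X$ for which Borel sets are measurable. Borel-regular means that each subset of $X$ is contained in some Borel set with the same measure (so $\mu$ is regarded as an outer measure on all subsets). $B(x,s)$ denotes the closed ball $\{y\in X : d(x,y)\le s\}$. All closed balls ($x\in X$, $s>0$) satisfy $0<\mu(B(x,s))<\infty$. Averaging operator: for a function $f$ integrable on balls, $A_rf(x)=\frac{1}{\mu(B(x,r))}\int_{B(x,r)} f(y)\,d\mu(y)$. For $s>0$, $X$ is $s$-doubling if there exists $\gamma\ge 1$ such that $\mu(B(x,2s))\le\gamma\,\mu(B(x,s))$ for all $x\in X$. Property $(\ast)_s$: for every $\epsilon>0$ there exists $\delta>0$ such that for all $x,y\in X$, if $d(x,y)<\delta$, then $\mu(B(x,s)\triangle B(y,s))<\epsilon$, where $\triangle$ is the symmetric difference. $L^\infty(X)$ is the (real) Lebesgue space of essentially bounded measurable functions with the essential supremum norm. *)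

(* Defs.v *)
From HB Require Import structures.
From mathcomp Require Import all_boot all_order all_algebra.
From mathcomp Require Import all_classical all_reals all_analysis.
From mathcomp Require Import measurable_realfun ess_sup_inf.
From mathcomp Require Import lra.

Set Implicit Arguments.
Unset Strict Implicit.
Unset Printing Implicit Defensive.
Import Order.TTheory GRing.Theory Num.Theory.
Import numFieldNormedType.Exports.

Local Open Scope classical_set_scope.
Local Open Scope ring_scope.
Local Open Scope quotient_scope.

(* The library provides the type of Lp classes, but neither its linear nor its
   normed structure; both are transported from LfunType along the quotient. *)
Section Lspace_normed.
Context d (T : measurableType d) (R : realType).
Variables (mu : {measure set T -> \bar R}) (p : \bar R) (p1 : (1 <= p)%E).
Notation L := (LspaceType mu p1).
Notation ty := (LfunType mu p1).
Implicit Types (f g : ty) (F G H : L).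

HB.instance Definition _ := gen_eqMixin (LspaceType mu p1).
HB.instance Definition _ := gen_choiceMixin (LspaceType mu p1).

Lemma ae_eq_Lnorm (f g : T -> R) : measurable_fun setT f ->
  measurable_fun setT g -> f = g %[ae mu] ->
  'N[mu]_p[EFin \o f]%E = 'N[mu]_p[EFin \o g]%E.
Proof.
move=> mf mg fg; rewrite unlock /Lnorm; case: p p1 => [r r1|_|//].
  have mpow (h : T -> R) : measurable_fun setT h ->
      measurable_fun setT (fun x => (`|(EFin \o h) x| `^ r)%E).
    move=> mh; apply/measurable_EFinP.
    apply: (@measurableT_comp _ _ _ _ _ _ (@powR R ^~ r)) => //.
    exact: measurableT_comp.
  congr poweR; apply: ge0_ae_eq_integral => //;
    [exact: mpow|exact: mpow|by move=> x _; exact: poweR_ge0..|].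
  by rewrite /ae_eq; apply: filterS fg => x /= fgx xT; rewrite fgx.
case: ifP => // _; apply: eq_ess_sup.
by apply: filterS fg => x /= ->.
Qed.

Section class.
Variable f : ty.
Let f' : T -> measurableTypeR R := f.
Let mf' : measurable_fun setT f'. Proof. exact: (measurable_funPT f). Qed.
HB.instance Definition _ :=
  isMeasurableFun.Build _ _ T (measurableTypeR R) f' mf'.

Let c : {mfun_ mu, T >-> measurableTypeR R} :=
  \pi_({mfun_ mu, T >-> measurableTypeR R})
    (f' : {mfun T >-> measurableTypeR R}).

Let c_ae : (c : T -> R) = f %[ae mu].
Proof.
have /eqmodP/asboolP := reprK c.
by [].
Qed.
Let c_fin : finite_norm mu p c.
Proof.
rewrite /finite_norm.
have mc : measurable_fun setT (c : T -> R).
  exact: (measurable_funPT (repr c)).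
have -> : 'N[mu]_p[EFin \o (c : T -> R)]%E = 'N[mu]_p[EFin \o f]%E.
  by apply: ae_eq_Lnorm.
exact: (@Lfunction_finite _ _ _ _ _ p1).
Qed.
HB.instance Definition _ := isFinLebesgue.Build d T R mu p p1 c c_fin.
Definition Lclass : L := c.
Lemma Lclass_ae : (Lclass : T -> R) = f %[ae mu].
Proof. exact: c_ae. Qed.
End class.

Section fun_of.
Variable F : L.
Let f : T -> R := F.
Let mf : measurable_fun setT f.
Proof.
exact: (measurable_funPT (repr (F : {mfun_ mu, T >-> measurableTypeR R}))).
Qed.
HB.instance Definition _ := isMeasurableFun.Build _ _ T R f mf.
Let ff : finite_norm mu p f. Proof. exact: Lebesgue_finite. Qed.
HB.instance Definition _ := isLfunction.Build _ T R mu p p1 f ff.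
Definition Lfun_of : ty := f.
Lemma Lfun_ofE : Lfun_of = F :> (T -> R). Proof. by []. Qed.
End fun_of.

Lemma Lspace_eqP F G : F = G <-> (F : T -> R) = G %[ae mu].
Proof.
split=> [->|]; first exact: ae_eq_refl.
case: F => F [[Ff]]; case: G => G [[Gf]] /= FG.
have FGE : F = G.
  by rewrite -(reprK F) -(reprK G); apply/eqmodP/asboolP.
case: G / FGE in Gf FG *.
by rewrite (Prop_irrelevance Ff Gf).
Qed.

Lemma Lclass_eqP f g : Lclass f = Lclass g <-> (f : T -> R) = g %[ae mu].
Proof.
rewrite Lspace_eqP; split => [fg|fg].
  apply: (ae_eq_trans _ (Lclass_ae g)); apply: (ae_eq_trans _ fg).
  exact/ae_eq_sym/Lclass_ae.
apply: (ae_eq_trans (Lclass_ae f)); apply: (ae_eq_trans fg).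
exact/ae_eq_sym/Lclass_ae.
Qed.

Lemma Lfun_ofK : cancel Lfun_of Lclass.
Proof. by move=> F; apply/Lspace_eqP; exact: Lclass_ae. Qed.

Let zero : L := Lclass 0.
Let opp F : L := Lclass (- Lfun_of F).
Let add F G : L := Lclass (Lfun_of F + Lfun_of G).
Let scale (a : R) F : L := Lclass (a *: Lfun_of F).

Let oppE f : opp (Lclass f) = Lclass (- f).
Proof.
apply/Lclass_eqP; apply: filterS (Lclass_ae f) => x /= /(_ I) fx _.
by rewrite /= !fctE fx.
Qed.

Let addE f g : add (Lclass f) (Lclass g) = Lclass (f + g).
Proof.
apply/Lclass_eqP; apply: filterS2 (Lclass_ae f) (Lclass_ae g).
by move=> x /= /(_ I) fx /(_ I) gx _; rewrite /= !fctE fx gx.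
Qed.

Let scaleE a f : scale a (Lclass f) = Lclass (a *: f).
Proof.
apply/Lclass_eqP; apply: filterS (Lclass_ae f) => x /= /(_ I) fx _.
by rewrite /= !fctE fx.
Qed.

Let addA : associative add.
Proof.
by move=> F G H; rewrite -[F]Lfun_ofK -[G]Lfun_ofK -[H]Lfun_ofK !addE addrA.
Qed.
Let addC : commutative add.
Proof. by move=> F G; rewrite -[F]Lfun_ofK -[G]Lfun_ofK !addE addrC. Qed.
Let add0 : left_id zero add.
Proof. by move=> F; rewrite -[F]Lfun_ofK addE add0r. Qed.
Let addN : left_inverse zero opp add.
Proof. by move=> F; rewrite -[F]Lfun_ofK oppE addE addNr. Qed.

HB.instance Definition _ :=
  GRing.isZmodule.Build (LspaceType mu p1) addA addC add0 addN.

Let scaleA a b F : scale a (scale b F) = scale (a * b) F.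
Proof. by rewrite -[F]Lfun_ofK !scaleE scalerA. Qed.
Let scale1 : left_id 1 scale.
Proof. by move=> F; rewrite -[F]Lfun_ofK scaleE scale1r. Qed.
Let scaleDr : right_distributive scale +%R.
Proof.
move=> a F G; rewrite -[F]Lfun_ofK -[G]Lfun_ofK.
by rewrite [LHS](congr1 _ (addE _ _)) !scaleE [RHS]addE scalerDr.
Qed.
Let scaleDl F : {morph scale^~ F : a b / a + b}.
Proof. by move=> a b; rewrite -[F]Lfun_ofK !scaleE [RHS]addE scalerDl. Qed.

HB.instance Definition _ := GRing.Zmodule_isLmodule.Build R (LspaceType mu p1)
  scaleA scale1 scaleDr scaleDl.

Lemma LclassD f g : Lclass (f + g) = Lclass f + Lclass g.
Proof. by rewrite -addE. Qed.

Lemma LclassZ a f : Lclass (a *: f) = a *: Lclass f.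
Proof. by rewrite -scaleE. Qed.

Let nrm F : R := fine 'N[mu]_p[EFin \o (F : T -> R)]%E.

Let nrmE f : nrm (Lclass f) = fine 'N[mu]_p[EFin \o f]%E.
Proof.
congr fine; apply: ae_eq_Lnorm => //; last exact: Lclass_ae.
Qed.

Let nrmD F G : nrm (F + G) <= nrm F + nrm G.
Proof.
by rewrite -[F]Lfun_ofK -[G]Lfun_ofK -LclassD !nrmE; exact: ler_LnormD.
Qed.
Let nrmZ a F : nrm (a *: F) = `|a| * nrm F.
Proof.
rewrite -[F]Lfun_ofK -LclassZ !nrmE; apply: EFin_inj.
by rewrite EFinM !finite_norm_fine LnormZ.
Qed.
Let nrm0 F : nrm F = 0 -> F = 0.
Proof.
rewrite -[F]Lfun_ofK nrmE => /fine_Lnormr_eq0 F0.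
by rewrite -[0]/(Lclass 0); apply/Lclass_eqP.
Qed.

HB.instance Definition _ := Lmodule_isNormed.Build R (LspaceType mu p1)
  nrmD nrmZ nrm0.

Lemma LspaceD_ae F G : (F + G : L) = (F : T -> R) \+ G %[ae mu].
Proof. exact: (Lclass_ae (Lfun_of F + Lfun_of G)). Qed.

Lemma LspaceZ_ae a F : (a *: F : L) = (fun x => a * F x) %[ae mu].
Proof. exact: (Lclass_ae (a *: Lfun_of F)). Qed.

Lemma Lspace_normE F : (`|F|)%:E = 'N[mu]_p[EFin \o (F : T -> R)]%E.
Proof. exact: (finite_norm_fine (Lfun_of F)). Qed.

End Lspace_normed.

(* measurableType is pointed in the library, hence so are the spaces below:
   they are exactly the nonempty metric spaces. *)
#[short(type="pmetricType")]
HB.structure Definition PointedMetric (K : numDomainType) :=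
  {M of Metric K M & isPointed M}.

Section metric_measure.
Context {R : realType} {X : pmetricType R}.
Variable mu : {outer_measure set X -> \bar R}.

(* Not the library's closed_ball, which is the closure of the open ball. *)
Definition cball (x : X) (s : R) : set X := [set y | mdist x y <= s].

Definition borel : set (set X) := <<s open >>.

Definition borel_measurable := forall A, borel A -> mu.-caratheodory A.

Definition borel_regular :=
  forall A, exists B, [/\ borel B, A `<=` B & mu B = mu A].

Definition pos_fin_balls :=
  forall (x : X) (s : R), 0 < s -> (0 < mu (cball x s) < +oo)%E.

Definition doubling (s : R) := exists2 gamma : R, 1 <= gamma &
  forall x, (mu (cball x (2 * s)) <= gamma%:E * mu (cball x s))%E.

Definition star_property (s : R) := forall eps : R, 0 < eps ->
  exists2 delta : R, 0 < delta &
  forall x y, mdist x y < delta -> (mu (cball x s `+` cball y s) < eps%:E)%E.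

(* mu as a (complete) measure on its Caratheodory measurable sets; this is the
   sigma-algebra with respect to which integrals and Linfty are taken. *)
Definition cmu : {measure set (caratheodory_type mu) -> \bar R} := mu.

Definition Linfty := LspaceType cmu (leey 1%:E).

Definition average (r : R) (f : X -> R) (x : X) : R :=
  (fine (mu (cball x r)))^-1 * \int[cmu]_(y in cball x r) f y.

Section averaging.
Variable r : R.
Hypotheses (bX : borel_measurable) (fX : pos_fin_balls) (r0 : 0 < r).
Notation T := (caratheodory_type mu).

Lemma measurable_open (A : set X) : open A -> measurable (A : set T).
Proof. by move=> oA; apply: bX; exact: sub_sigma_algebra. Qed.

Lemma closed_cball x s : closed (cball x s).
Proof.
rewrite -[cball x s]setCK closedC openE => y /= /negP; rewrite -ltNge => sxy.
have e0 : 0 < mdist x y - s by rewrite subr_gt0.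
apply/nbhs_ballP; exists (mdist x y - s) => //= z; rewrite ballEmdist/= => yz.
apply/negP; rewrite -ltNge.
by have := metric_triangle x z y; rewrite (metric_sym z y); lra.
Qed.

Lemma measurable_cball x s : measurable (cball x s : set T).
Proof.
rewrite -[cball x s]setCK; apply/measurableC/measurable_open/closed_openC.
exact: closed_cball.
Qed.

Let mball x s : measurable (cball x s : set T).
Proof. exact: measurable_cball. Qed.

Section ballint.
Variable h : T -> \bar R.
Hypotheses (h0 : forall x, (0 <= h x)%E)
  (ih : forall x s, 0 < s -> cmu.-integrable (cball x s) h).

Lemma measurable_ballint : measurable_fun (setT : set T)
  (fun x => \int[cmu]_(y in cball x r) h y)%E.
Proof.
apply: (measurability _ (ErealGenInftyO.measurableE R)) => _ /= -[_ [c ->] <-].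
rewrite setTI; apply: measurable_open; rewrite openE => x /=.
rewrite in_itv/= => xc.
pose A n := cball x (r + n.+1%:R^-1).
have rn n : 0 < r + n.+1%:R^-1 by rewrite addr_gt0.
have ihr s : 0 < s -> cmu.-integrable setT (h \_ (cball x s)).
  by move=> s0; apply/(integrable_mkcond _ (mball x s)); exact: ih.
have cvgA : (\int[cmu]_(y in A n) h y)%E @[n --> \oo] -->
    (\int[cmu]_(y in cball x r) h y)%E.
  rewrite integral_mkcond; under eq_fun do rewrite integral_mkcond.
  have [] // := @dominated_convergence _ _ _ cmu setT measurableT
    (fun n => h \_ (A n)) (h \_ (cball x r)) (h \_ (A 0)).
  - by move=> n; exact: (measurable_int cmu (ihr _ (rn n))).
  - exact: (measurable_int cmu (ihr _ r0)).
  - apply: aeW => y _; have [xy|xy] := leP (mdist x y) r.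
      rewrite [X in _ --> X]patchT ?inE//.
      apply: cvg_near_cst; near=> n.
      by rewrite patchT// inE /A /cball/= (le_trans xy)// lerDl.
    have xyr : 0 < mdist x y - r by rewrite subr_gt0.
    rewrite [X in _ --> X]patchN; last first.
      by rewrite notin_setE/= /cball/=; apply/negP; rewrite -ltNge.
    apply: cvg_near_cst; near=> n.
    rewrite patchN// notin_setE /A /cball/=; apply/negP; rewrite -ltNge.
    rewrite -ltrBrDl; near: n; exact: (near_infty_natSinv_lt (PosNum xyr)).
  - exact: ihr.
  - apply: aeW => y n _; rewrite /patch; case: ifPn => [|_].
      rewrite inE /A/= => yA; rewrite ifT; first by rewrite gee0_abs.
      rewrite inE /cball/=; apply: (le_trans yA).
      by rewrite lerD2l lef_pV2 ?posrE// ler_nat.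
    by rewrite abse0; case: ifP.
have /(cvgA (fun t => t < c%:E)%E) [N _ /(_ N (leqnn N)) /= AN] :
    nbhs (\int[cmu]_(y in cball x r) h y)%E [set t | (t < c%:E)%E].
  by apply: open_nbhs_nbhs; split => //; exact: open_ereal_lt_ereal.
apply/nbhs_ballP; exists N.+1%:R^-1 => /=; first by rewrite invr_gt0.
move=> y; rewrite ballEmdist/= => xy; rewrite in_itv/=; apply: le_lt_trans AN.
apply: ge0_subset_integral => //.
- exact: mball.
- exact: (measurable_int cmu (ih _ (rn N))).
- move=> z; rewrite /cball/= => yz.
  by rewrite /A /cball/= (le_trans (metric_triangle x y z))// addrC lerD// ltW.
Unshelve. all: by end_near. Qed.
End ballint.

Let mu_ball x s : 0 < s -> mu (cball x s) = (fine (mu (cball x s)))%:E.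
Proof.
by move=> /(fX x) /andP[b0 boo]; rewrite fineK// ge0_fin_numE ?(ltW b0).
Qed.

Let fine_ball_gt0 x : 0 < fine (mu (cball x r)).
Proof. by rewrite fine_gt0 ?fX. Qed.

Lemma muT_gt0 : (0 < cmu setT)%E.
Proof.
have /andP[b0 _] := fX point r0.
exact: (lt_le_trans b0 (le_outer_measure mu _ _ (@subsetT _ _))).
Qed.

Lemma Linfty_bounded (F : Linfty) :
  exists2 M : R, 0 <= M & \forall y \ae cmu, `|F y| <= M.
Proof.
have := Lebesgue_finite (s := F).
rewrite /finite_norm unlock /Lnorm muT_gt0.
move=> /(@ess_supr_bounded _ _ _ _ (fun y => `|F y|)) [M FM].
exists (Num.max 0 M); first by rewrite le_max lexx.
by apply: filterS FM => y yM; rewrite le_max yM orbT.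
Qed.

Lemma measurable_Linfty (F : Linfty) : measurable_fun setT (F : T -> R).
Proof. exact: (measurable_funPT (Lfun_of F)). Qed.

Lemma integrable_Linfty (F : Linfty) x s : 0 < s ->
  cmu.-integrable (cball x s) (EFin \o (F : T -> R)).
Proof.
move=> s0; have [M M0 FM] := Linfty_bounded F.
have mF : measurable_fun (cball x s : set T) (EFin \o (F : T -> R)).
  apply/measurable_EFinP; apply: measurable_funTS; exact: measurable_Linfty.
apply/integrableP; split => //.
apply: (@le_lt_trans _ _ (M%:E * cmu (cball x s))%E).
  apply: integral_le_bound => //.
  by apply: filterS FM => y yM _; rewrite lee_fin.
by rewrite [cmu _]mu_ball// -EFinM ltry.
Qed.

Lemma measurable_average (F : Linfty) :
  measurable_fun setT (average r F : T -> R).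
Proof.
apply: measurable_funM.
  rewrite (_ : (fun x => _) = (@powR R ^~ (-1)) \o
      (fine \o (fun x => \int[cmu]_(y in cball x r) cst 1%E y)%E)).
    apply: measurableT_comp; first exact: measurable_powR.
    apply: measurableT_comp; first exact: fine_measurable.
    apply: measurable_ballint => // x s s0; apply/integrableP; split => //.
    under eq_integral do rewrite /= normr1.
    by rewrite integral_cst ?mul1e; [case/andP: (fX x s0)|exact: mball].
  apply/funext => x /=; rewrite integral_cst ?mul1e; last exact: mball.
  by rewrite powR_inv1// ltW// fine_ball_gt0.
rewrite (_ : (fun x => _) = fine \o
  ((fun x => \int[cmu]_(y in cball x r) (EFin \o (F : T -> R))^\+ y) \-
   (fun x => \int[cmu]_(y in cball x r) (EFin \o (F : T -> R))^\- y))%E);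
  last first.
  by apply/funext => x; rewrite /= /Rintegral integralE.
apply: measurableT_comp; first exact: fine_measurable.
apply: emeasurable_funB; apply: measurable_ballint => // x s s0.
- exact/integrable_funepos/integrable_Linfty.
- exact/integrable_funeneg/integrable_Linfty.
Qed.

Lemma average_le (F : Linfty) (M : R) x : 0 <= M ->
  (\forall y \ae cmu, `|F y| <= M) -> `|average r F x| <= M.
Proof.
move=> M0 FM; have iF := integrable_Linfty F x r0.
rewrite normrM ger0_norm ?invr_ge0 ?(ltW (fine_ball_gt0 x))//.
rewrite mulrC ler_pdivrMr// -lee_fin EFinM -mu_ball//.
rewrite EFin_normr_Rintegral//.
have mF := measurable_int cmu iF.
apply: (le_trans (le_abse_integral cmu (mball x r) mF)).
apply: integral_le_bound => //.
by apply: filterS FM => y yM _; rewrite lee_fin.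
Qed.

Lemma average_Lfun (F : Linfty) : (average r F : T -> R) \in Lfun cmu +oo%E.
Proof.
rewrite inE; apply/andP; split; rewrite inE/=; first exact: measurable_average.
rewrite /finite_norm unlock /Lnorm muT_gt0.
have [M M0 FM] := Linfty_bounded F.
apply: (@le_lt_trans _ _ M%:E); last exact: ltry.
by apply: ess_sup_ler => x; rewrite lee_fin average_le.
Qed.

Definition averaging_op (F : Linfty) : Linfty :=
  Lclass (@Lfun_Sub _ _ R cmu _ (leey 1%:E) _ (average_Lfun F)).

Lemma averaging_opE F : (averaging_op F : T -> R) = average r F %[ae cmu].
Proof. exact: Lclass_ae. Qed.

Lemma eq_average (f g : T -> R) x : measurable_fun setT f ->
  measurable_fun setT g -> f = g %[ae cmu] -> average r f x = average r g x.
Proof.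
move=> mf mg fg; congr (_ * fine _); apply: ae_eq_integral; first exact: mball.
- by apply/measurable_EFinP/measurable_funTS.
- by apply/measurable_EFinP/measurable_funTS.
- by rewrite /ae_eq; apply: filterS fg => y /= fgy _; rewrite fgy.
Qed.

Lemma averaging_op_linear : linear averaging_op.
Proof.
move=> a F G; rewrite -LclassZ -LclassD; apply/Lclass_eqP.
apply: aeW => x _.
transitivity (a * average r F x + average r G x); last by [].
have iF := integrable_Linfty F x r0; have iG := integrable_Linfty G x r0.
transitivity (average r (fun y => a * F y + G y) x).
  apply: eq_average; first exact: measurable_Linfty.
    apply: measurable_funD; last exact: measurable_Linfty.
    by apply: measurable_funM => //; exact: measurable_Linfty.
  apply: filterS2 (LspaceD_ae (a *: F) G) (LspaceZ_ae a F).
  by move=> y /= /(_ I) -> /(_ I) -> _.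
rewrite /average RintegralD//; last exact: (integrableZl (mball x r) a iF).
rewrite RintegralZl// mulrDr; congr (_ + _); exact: mulrCA.
Qed.

HB.instance Definition _ := GRing.isLinear.Build R Linfty Linfty *:%R
  averaging_op averaging_op_linear.

End averaging.

End metric_measure.

Definition bounded_space (R : realType) (X : pmetricType R) :=
  exists M : R, forall x y : X, mdist x y <= M.

Definition compact_operator (R : realType) (V W : normedModType R)
    (A : {linear V -> W}) :=
  forall B : set V, bounded_set B -> precompact (A @` B).

(* Main.v *)
(** If [X] is bounded, doubling at all scales bounds the measure of balls of a
    given radius from below, and packing disjoint balls shows that [X] is
    totally bounded.  Together with [star_property] the lower bound makes the
    averages of the functions of a ball of Linfty uniformly equicontinuous, and
    an Arzela-Ascoli argument, in which the pointwise limit along an ultrafilter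
    is uniform because it is controlled on a finite net, gives compactness.

    If [X] is unbounded and [d(x, y) > 4r], the averages of the indicators of
    [B(x, 2r)] and [B(y, 2r)] are [1] and [0] on [B(x, r)], so their images are
    at distance at least [1], which no compact set allows for points [x]
    escaping to infinity. *)
Require Import Defs.
From mathcomp Require Import all_boot all_order all_algebra.
From mathcomp Require Import all_classical all_reals all_analysis.
From mathcomp Require Import measurable_realfun ess_sup_inf ring lra.
Import Order.TTheory GRing.Theory Num.Theory.
Import numFieldNormedType.Exports.
Local Open Scope classical_set_scope.
Local Open Scope ring_scope.
Set Implicit Arguments.
Unset Strict Implicit.
Unset Printing Implicit Defensive.

(** * Integrals of essentially bounded functions over sets of finite measure *)

Lemma normr_Rintegral_le d (T : measurableType d) (R : realType)
    (mu : {measure set T -> \bar R}) (D : set T) (f : T -> R) (M : R) :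
  measurable D -> (mu D < +oo)%E -> measurable_fun setT f -> 0 <= M ->
  (\forall y \ae mu, `|f y| <= M) ->
  mu.-integrable D (EFin \o f) /\
  `|\int[mu]_(y in D) f y| <= M * fine (mu D).
Proof.
move=> mD Doo mf M0 fM.
have muDE : mu D = (fine (mu D))%:E by rewrite fineK// ge0_fin_numE.
have mfD : measurable_fun D (EFin \o f).
  exact/measurable_EFinP/measurable_funTS.
have le_b : (\int[mu]_(y in D) `|(EFin \o f) y| <= M%:E * mu D)%E.
  apply: integral_le_bound => //.
  by apply: filterS fM => y yM _; rewrite lee_fin.
have iD : mu.-integrable D (EFin \o f).
  apply/integrableP; split => //; apply: (le_lt_trans le_b).
  by rewrite muDE -EFinM ltry.
split => //; rewrite -lee_fin EFinM -muDE EFin_normr_Rintegral//.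
exact: le_trans (le_abse_integral mu mD mfD) le_b.
Qed.

(** The integrals over [A] and [B] share the part over their intersection, which cancels; the two
    differences remain, and their measures add up to that of [A]+[B]. *)
Lemma normr_RintegralB_le d (T : measurableType d) (R : realType)
    (mu : {measure set T -> \bar R}) (A B : set T) (f : T -> R) (M : R) :
  measurable A -> measurable B -> (mu A < +oo)%E -> (mu B < +oo)%E ->
  measurable_fun setT f -> 0 <= M -> (\forall y \ae mu, `|f y| <= M) ->
  `|\int[mu]_(y in A) f y - \int[mu]_(y in B) f y| <= M * fine (mu (A `+` B)).
Proof.
move=> mA mB Aoo Boo mf M0 fM.
have lt_oo C D : measurable C -> measurable D -> C `<=` D ->
    (mu D < +oo)%E -> (mu C < +oo)%E.
  by move=> mC mD CD; apply: le_lt_trans; apply: le_measure; rewrite ?inE.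
have split_int C D : measurable C -> measurable D -> (mu C < +oo)%E ->
    \int[mu]_(y in C) f y =
    \int[mu]_(y in C `&` D) f y + \int[mu]_(y in C `\` D) f y.
  move=> mC mD Coo; rewrite -{1}(setUIDK C D) Rintegral_setU//.
  - exact: measurableI.
  - exact: measurableD.
  - by rewrite setUIDK; have [] := normr_Rintegral_le mC Coo mf M0 fM.
  - by apply/disj_setPS => y [[_ Dy] [_]]; exact.
have mAB := measurableD mA mB; have mBA := measurableD mB mA.
have AB : (mu (A `\` B) < +oo)%E by apply: (lt_oo _ A) => // x [].
have BA : (mu (B `\` A) < +oo)%E by apply: (lt_oo _ B) => // x [].
rewrite (split_int A B)// (split_int B A)// (setIC B A).
have [_ lAB] := normr_Rintegral_le mAB AB mf M0 fM.
have [_ lBA] := normr_Rintegral_le mBA BA mf M0 fM.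
rewrite /setY measureU//; last first.
  by apply/seteqP; split => // y [[Ay _] [_ /(_ Ay)]].
rewrite fineD ?ge0_fin_numE// mulrDr opprD addrACA subrr add0r.
exact: le_trans (ler_normB _ _) (lerD lAB lBA).
Qed.

Lemma closed_normr_le (R : realType) (M : R) : closed [set t : R | `|t| <= M].
Proof.
by apply: (preimage_closed _ (@closed_le R M)) => x _; exact: norm_continuous.
Qed.

(** * The norm of [Linfty] and compactness of equicontinuous families *)

Section linfty.
Context {R : realType} {X : pmetricType R}.
Variable mu : {outer_measure set X -> \bar R}.
Hypotheses (bX : borel_measurable mu) (fX : pos_fin_balls mu).
Notation T := (caratheodory_type mu).

Let muT0 : (0 < cmu mu setT)%E.
Proof. exact: (muT_gt0 fX (@ltr01 R)). Qed.

Lemma Linfty_norm_leP (F : Linfty mu) (M : R) :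
  `|F| <= M <-> \forall y \ae cmu mu, `|F y| <= M.
Proof.
rewrite -lee_fin Lspace_normE unlock /Lnorm muT0.
split => [/ess_supP|FM]; last apply/ess_supP.
  by apply: filterS => y; rewrite /= lee_fin.
by apply: filterS FM => y; rewrite /= lee_fin.
Qed.

Lemma bounded_Linfty (f : X -> R) (M : R) :
  measurable_fun setT (f : T -> R) -> (forall x, `|f x| <= M) ->
  exists F : Linfty mu, (F : T -> R) = f %[ae cmu mu].
Proof.
move=> mf fM.
have fL : (f : T -> R) \in Lfun (cmu mu) +oo%E.
  rewrite inE; apply/andP; split; rewrite inE//=.
  rewrite /finite_norm unlock /Lnorm muT0.
  apply: (@le_lt_trans _ _ M%:E); last exact: ltry.
  by apply: ess_sup_ler => x; rewrite lee_fin fM.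
exists (Lclass (@Lfun_Sub _ _ R (cmu mu) _ (leey 1%:E) _ fL)).
exact: Lclass_ae.
Qed.

Lemma Linfty_sub_ae (F G : Linfty mu) (f g : T -> R) :
  (F : T -> R) = f %[ae cmu mu] -> (G : T -> R) = g %[ae cmu mu] ->
  \forall y \ae cmu mu, (F - G : Linfty mu) y = f y - g y.
Proof.
move=> Ff Gg; rewrite -scaleN1r.
apply: filterS2 (filterI Ff Gg)
  (filterI (LspaceD_ae F (-1 *: G)) (LspaceZ_ae (-1) G)) => y.
move=> [/(_ I) Ffy /(_ I) Ggy] [/(_ I) -> /(_ I) Zy].
by rewrite /= Zy Ffy Ggy mulN1r.
Qed.

Lemma Linfty_dist_le (F G : Linfty mu) (f g : T -> R) (e : R) :
  (F : T -> R) = f %[ae cmu mu] -> (G : T -> R) = g %[ae cmu mu] ->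
  (forall x, `|f x - g x| <= e) -> `|F - G| <= e.
Proof.
move=> Ff Gg fge; apply/Linfty_norm_leP.
by apply: filterS (Linfty_sub_ae Ff Gg) => y ->.
Qed.

(** If the norm were below [e], then [A] would lie in a null set, against monotonicity of the outer
    measure. *)
Lemma Linfty_dist_ge (F G : Linfty mu) (f g : T -> R) (e : R) (A : set X) :
  (F : T -> R) = f %[ae cmu mu] -> (G : T -> R) = g %[ae cmu mu] ->
  (0 < mu A)%E -> (forall x, A x -> e <= `|f x - g x|) -> e <= `|F - G|.
Proof.
move=> Ff Gg A0 fge; rewrite leNgt; apply/negP => FGe.
have /Linfty_norm_leP FG := lexx `|F - G|.
have [N [mN N0 subN]] : \forall y \ae cmu mu, ~ A y.
  apply: filterS2 FG (Linfty_sub_ae Ff Gg) => y FGy fgy Ay.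
  have := fge y Ay; rewrite -fgy => /le_trans/(_ FGy).
  by rewrite leNgt FGe.
have AN : A `<=` N by move=> y Ay; apply: subN => /=; exact.
have := le_outer_measure mu _ _ AN.
by rewrite [X in (_ <= X)%E]N0 leNgt A0.
Qed.

(** One modulus [delta] serves the whole family, and the weak inequalities make the family stable
    under pointwise limits. *)
Definition bounded_equicont (M : R) (delta : R -> R) : set (X -> R) :=
  [set f | (forall x, `|f x| <= M) /\
    forall e, 0 < e -> forall x y, mdist x y < delta e -> `|f x - f y| <= e].

Lemma measurable_bounded_equicont (M : R) (delta : R -> R) (f : X -> R) :
  (forall e, 0 < e -> 0 < delta e) -> bounded_equicont M delta f ->
  measurable_fun setT (f : T -> R).
Proof.
move=> delta0 [_ fe].
apply: (measurability _ (RGenOInfty.measurableE R)) => _ /= -[_ [c ->] <-].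
rewrite setTI; apply: (measurable_open bX); rewrite openE => x /=.
rewrite in_itv/= andbT => cx.
(* An oscillation of at most half the gap keeps [f y] strictly above [c], so superlevel sets are
   open. *)
have e0 : 0 < (f x - c) / 2 by rewrite divr_gt0// subr_gt0.
apply/nbhs_ballP; exists (delta ((f x - c) / 2)) => /=; first exact: delta0.
move=> y; rewrite ballEmdist/= => xy; rewrite in_itv/= andbT.
have := fe _ e0 x y xy; rewrite ler_norml => /andP[_]; lra.
Qed.

(** Arzela-Ascoli for classes: elements of [Linfty] have no pointwise values, so the family consists
    of the classes that have an equicontinuous representative. *)
Lemma compact_bounded_equicont (M : R) (delta : R -> R) :
  (forall e, 0 < e -> 0 < delta e) ->
  (forall e : R, 0 < e ->
    exists s : seq X, forall x, exists2 y, y \in s & mdist x y < e) ->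
  compact [set F : Linfty mu |
    exists2 f, bounded_equicont M delta f & (F : T -> R) = f %[ae cmu mu]].
Proof.
move=> delta0 tbX; set K := [set F | _]; rewrite compact_ultra => U UU UK.
have [rep repP] : {rep : Linfty mu -> X -> R & forall F, K F ->
    bounded_equicont M delta (rep F) /\ (F : T -> R) = rep F %[ae cmu mu]}.
  apply: (@choice _ _ (fun F f => K F ->
    bounded_equicont M delta f /\ (F : T -> R) = f %[ae cmu mu])) => F.
  have [[f fK Ff]|nK] := pselect (K F); first by exists f.
  by exists (fun=> 0) => /nK.
(* At each [x] the values lie in the compact segment [[- M, M]], so the image ultrafilter
   converges. *)
have [g gP] : {g : X -> R & forall x, rep F x @[F --> U] --> g x}.
  apply: (@choice _ _ (fun x (l : R) => rep F x @[F --> U] --> l)) => x.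
  have := @segment_compact R (- M) M.
  have UV : UltraFilter (rep F x @[F --> U]).
    split=> [|G PG UG]; first exact: fmap_proper_filter.
    apply/seteqP; split => [A GA|]; last exact: UG.
    have [//|nA] := in_ultra_setVsetC ((rep^~ x) @^-1` A) UU.
    have nGA : G (~` A) by exact: UG.
    by have [t []] := filter_ex (filterI GA nGA).
  rewrite compact_ultra => /(_ _ UV)[|l [_ lP]]; last by exists l.
  suff: \forall F \near U, rep F x \in `[- M, M] by [].
  by apply: filterS UK => F /repP[[FM _] _]; rewrite in_itv/= -ler_norml.
have gK : bounded_equicont M delta g.
  split => [x|e e0 x y xy].
    apply: (closed_cvg (fun t : R => `|t| <= M) _ _ _ (gP x)).
      exact: closed_normr_le.
    by apply: filterS UK => F /repP[[FM _] _] /=.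
  apply: (closed_cvg (fun t : R => `|t| <= e) _ _ _ (cvgB (gP x) (gP y))).
    exact: closed_normr_le.
  by apply: filterS UK => F /repP[[_ /(_ e e0 x y xy)]].
have [G Gg] := bounded_Linfty (measurable_bounded_equicont delta0 gK) gK.1.
exists G; split; first by exists g.
apply/cvgrPdist_le => e e0 /=.
(* One third each for moving [g] from [x] to a net point, comparing [g] with [rep F] there, and
   moving [rep F] back to [x]. *)
have e30 : 0 < e / 3 by rewrite divr_gt0.
have [s sP] := tbX _ (delta0 _ e30).
have Us : \forall F \near U, forall y, y \in s -> `|g y - rep F y| <= e / 3.
  elim: s {sP} => [|a s IH]; first exact: nearW.
  have /cvgrPdist_le/(_ _ e30) ga := gP a.
  apply: filterS2 ga IH => F ga IH y; rewrite inE => /orP[/eqP->//|].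
  exact: IH.
apply: filterS2 UK Us => F /repP[[_ Fe] FF] Fs.
apply: (Linfty_dist_le Gg FF) => x.
have [y ys xy] := sP x.
have := Fs y ys; have := Fe _ e30 x y xy; have := gK.2 _ e30 x y xy.
rewrite !ler_norml; move=> /andP[? ?] /andP[? ?] /andP[? ?].
by apply/andP; split; lra.
Qed.

End linfty.

(** * Lower bounds for the measure of balls, and total boundedness *)

Section doubling.
Context {R : realType} {X : pmetricType R}.
Variable mu : {outer_measure set X -> \bar R}.
Hypotheses (bX : borel_measurable mu) (fX : pos_fin_balls mu).
Hypothesis doubX : forall s : R, 0 < s -> doubling mu s.
Notation T := (caratheodory_type mu).

(** The constant is a product of doubling constants at the radii [2 ^+ k * s] with [k < n]; it
    depends on [s] and [n] but not on [x]. *)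
Lemma doubling_iter (s : R) (n : nat) : 0 < s -> exists2 gamma : R, 0 < gamma &
  forall x, (mu (cball x (2 ^+ n * s)) <= gamma%:E * mu (cball x s))%E.
Proof.
move=> s0; elim: n => [|n [g g0 IH]].
  by exists 1 => // x; rewrite expr0 mul1r mul1e.
have [g' g'1 dn] := doubX (mulr_gt0 (exprn_gt0 n (@ltr0n R 2)) s0).
have g'0 : 0 < g' by exact: lt_le_trans g'1.
exists (g' * g) => [|x]; first exact: mulr_gt0.
rewrite exprS -mulrA; apply: (le_trans (dn x)).
by rewrite EFinM -muleA lee_pmul2l// ltry.
Qed.

Hypothesis bndX : bounded_space X.

Lemma bounded_space_cball : exists2 D : R, 0 < D &
  forall s (x : X), D <= s -> cball x s = setT.
Proof.
have [D DX] := bndX; exists (Num.max 1 D) => [|s x].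
  by rewrite lt_max ltr01.
rewrite ge_max => /andP[_ Ds]; apply/seteqP; split => // y _.
exact: le_trans (DX x y) Ds.
Qed.

Lemma cball_measure_ge (s : R) : 0 < s ->
  exists2 c : R, 0 < c & forall x, (c%:E <= mu (cball x s))%E.
Proof.
move=> s0; have [D D0 DX] := bounded_space_cball.
(* Since [n] exceeds [D / s] and [2 ^+ n] exceeds [n], the balls of radius [2 ^+ n * s] are the
   whole space. *)
pose n := Num.bound (D / s).
have Dn : D <= 2 ^+ n * s.
  rewrite -ler_pdivrMr//.
  apply: (le_trans (ltW (archi_boundP (divr_ge0 (ltW D0) (ltW s0))))).
  by rewrite -natrX ler_nat ltnW// ltn_expl.
have [g g0 gP] := doubling_iter n s0.
(* The space is itself a ball, hence of positive finite measure. *)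
have /andP[T0 Too] := fX point D0; rewrite DX// in T0 Too.
have TE : mu setT = (fine (mu setT))%:E by rewrite fineK// ge0_fin_numE// ltW.
exists (g^-1 * fine (mu setT)) => [|x].
  by rewrite mulr_gt0 ?invr_gt0// fine_gt0// T0.
have := gP x; rewrite (DX (2 ^+ n * s))// EFinM -TE.
by rewrite lee_pdivrMl.
Qed.

Lemma finite_net (e : R) : 0 < e ->
  exists s : seq X, forall x, exists2 y, y \in s & mdist x y < e.
Proof.
move=> e0; apply: contrapT => nnet.
have e30 : 0 < e / 3 by rewrite divr_gt0.
have [c c0 cP] := cball_measure_ge e30.
pose U (s : seq X) := \big[setU/set0]_(y <- s) cball y (e / 3).
have mU s : measurable (U s : set T).
  by apply: bigsetU_measurable => y _; exact: measurable_cball.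
(* As no finite list is an [e]-net, a point at distance at least [e] from the list can always be
   added; each addition contributes measure at least [c]. *)
have packing n : exists s, ((n%:R * c)%:E <= mu (U s))%E.
  elim: n => [|n [s IH]]; first by exists [::]; rewrite mul0r.
  have [x xs] : exists x, forall y, y \in s -> e <= mdist x y.
    apply: contrapT => nx; apply: nnet; exists s => x; apply: contrapT => ny.
    apply: nx; exists x => y ys; rewrite leNgt; apply/negP => xy.
    by apply: ny; exists y.
  exists (x :: s); rewrite /U big_cons.
  have -> : mu (cball x (e / 3) `|` U s) = (mu (cball x (e / 3)) + mu (U s))%E.
    apply: (measureU (cmu mu)) => //; first exact: measurable_cball.
    (* A common point of two balls of radius [e / 3] would put their centres within [2 * e / 3] of
       each other. *)
    apply/seteqP; split => // z [xz]; rewrite /U -bigcup_seq => -[y /= ys yz].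
    have := xs y ys; have := metric_triangle x z y; rewrite (metric_sym z y).
    move: xz yz; rewrite /cball/=; lra.
  rewrite -natr1 mulrDl mul1r addrC EFinD; exact: leeD.
have [D D0 DX] := bounded_space_cball.
have /andP[T0 Too] := fX point D0; rewrite DX// in T0 Too.
have TE : mu setT = (fine (mu setT))%:E by rewrite fineK// ge0_fin_numE// ltW.
have [s] := packing (Num.bound (fine (mu setT) / c)).
move=> /le_trans /(_ (le_outer_measure mu _ _ (@subsetT _ _))).
rewrite TE lee_fin -ler_pdivlMr// leNgt archi_boundP//.
by rewrite divr_ge0 ?fine_ge0// ltW.
Qed.

End doubling.

(** * Variation of averages between two points, and averages of indicators *)

Section average.
Context {R : realType} {X : pmetricType R}.
Variables (mu : {outer_measure set X -> \bar R}) (r : R).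
Hypotheses (bX : borel_measurable mu) (fX : pos_fin_balls mu) (r0 : 0 < r).
Notation T := (caratheodory_type mu).

Lemma average_dist_le (f : T -> R) (M : R) (x y : X) :
  measurable_fun setT f -> 0 <= M -> (\forall z \ae cmu mu, `|f z| <= M) ->
  `|average mu r f x - average mu r f y| <=
  2 * M * fine (mu (cball x r `+` cball y r)) / fine (mu (cball x r)).
Proof.
move=> mf M0 fM; rewrite /average.
have mb z : measurable (cball z r : set T) := measurable_cball bX z r.
have /andP[ax0 axoo] := fX x r0; have /andP[ay0 ayoo] := fX y r0.
set S := fine (mu (_ `+` _)).
have dI := normr_RintegralB_le (mb x) (mb y) axoo ayoo mf M0 fM.
have d1 : `|fine (mu (cball x r)) - fine (mu (cball y r))| <= S.
  (* The same estimate for the constant function 1 compares the measures of the two balls. *)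
  have := @normr_RintegralB_le _ T _ (cmu mu) _ _ (cst 1) 1 (mb x) (mb y)
    axoo ayoo (measurable_cst _) ler01.
  rewrite !Rintegral_cst// !mul1r; apply.
  by apply: aeW => z; rewrite /= normr1.
have [_ lJ] := normr_Rintegral_le (mb y) ayoo mf M0 fM.
have a0 : 0 < fine (mu (cball x r)) by rewrite fine_gt0// ax0.
have b0 : 0 < fine (mu (cball y r)) by rewrite fine_gt0// ay0.
move: dI d1 lJ a0 b0; rewrite -/S.
set a := fine (mu (cball x r)); set b := fine (mu (cball y r)).
set I := Rintegral (cmu mu) (cball x r) f.
set J := Rintegral (cmu mu) (cball y r) f.
move=> dI d1 lJ a0 b0.
(* In this form [I - J] is at most [M * S], [a - b] at most [S] and [J / b] at most [M] in absolute
   value. *)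
have -> : a^-1 * I - b^-1 * J = (I - J - (a - b) * (J / b)) / a.
  by field; rewrite !gt_eqF.
rewrite normrM [`|a^-1|]gtr0_norm ?invr_gt0// ler_wpM2r ?invr_ge0 ?(ltW a0)//.
apply: (le_trans (ler_normB _ _)).
rewrite -mulrA mulr_natl mulr2n lerD// normrM mulrC ler_pM//.
by rewrite normrM [`|b^-1|]gtr0_norm ?invr_gt0// ler_pdivrMr.
Qed.

Lemma average_indic (x y : X) (s : R) :
  average mu r (\1_(cball x s) : T -> R) y =
  fine (mu (cball x s `&` cball y r)) / fine (mu (cball y r)).
Proof.
rewrite /average /Rintegral mulrC integral_indic//; exact: measurable_cball.
Qed.

End average.

(** * Compactness of the averaging operator and boundedness of the space *)

Section compactness.
Context {R : realType} {X : pmetricType R}.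
Variables (mu : {outer_measure set X -> \bar R}) (r : R).
Hypotheses (bX : borel_measurable mu) (fX : pos_fin_balls mu) (r0 : 0 < r).
Notation T := (caratheodory_type mu).

Lemma averaging_op_compact : (forall s : R, 0 < s -> doubling mu s) ->
  star_property mu r -> bounded_space X ->
  compact_operator (averaging_op bX fX r0).
Proof.
move=> doubX starX bndX B /pinfty_ex_gt0 [M M0 BM].
have [c c0 cP] := cball_measure_ge fX doubX bndX r0.
(* The tolerance is chosen so that the bound of [average_dist_le], with ball measures at least [c],
   becomes exactly [e]. *)
have [delta deltaP] : {delta : R -> R & forall e, 0 < e -> 0 < delta e /\
    forall x y, mdist x y < delta e ->
      (mu (cball x r `+` cball y r) < (e * c / (2 * M))%:E)%E}.
  apply: (@choice _ _ (fun e d => 0 < e -> 0 < d /\ forall x y, mdist x y < d ->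
    (mu (cball x r `+` cball y r) < (e * c / (2 * M))%:E)%E)) => e.
  have [e0|e0] := ltP 0 e; last by exists 0.
  have k0 : 0 < e * c / (2 * M) by rewrite divr_gt0 ?mulr_gt0.
  by have [d d0 dP] := starX _ k0; exists d.
have delta0 e : 0 < e -> 0 < delta e by move=> /deltaP[].
have cK := compact_bounded_equicont bX fX (M := M) delta0
  (finite_net bX fX doubX bndX).
eexists; last first.
  by split; [exact: cK|exact: (compact_closed (@norm_hausdorff _ _) cK)].
(* The average itself, defined at every point, is the equicontinuous representative of its class. *)
move=> _ [F BF <-]; exists (average mu r F); last exact: averaging_opE.
have /(Linfty_norm_leP fX) FM := BM F BF.
split => [x|e e0 x y xy]; first exact: average_le (ltW M0) FM.
apply: le_trans (average_dist_le bX fX r0 _ _ _ (ltW M0) FM) _.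
  exact: measurable_Linfty.
have /andP[x0 xoo] := fX x r0.
rewrite ler_pdivrMr; last by rewrite fine_gt0// x0.
have [_ /(_ x y xy)] := deltaP e e0.
set S := mu (_ `+` _) => Slt.
have Sle : fine S <= e * c / (2 * M).
  rewrite -lee_fin fineK ?(ltW Slt)// ge0_fin_numE ?outer_measure_ge0//.
  exact: lt_trans Slt (ltry _).
have ca : c <= fine (mu (cball x r)).
  by rewrite -lee_fin fineK// ge0_fin_numE// ltW.
rewrite mulrC -ler_pdivlMr ?mulr_gt0//; apply: (le_trans Sle).
by rewrite ler_pM2r ?invr_gt0 ?mulr_gt0// ler_pM2l.
Qed.

(** For [z] in [cball x r], the ball [cball z r] lies inside [cball x (2 * r)] and misses
    [cball y (2 * r)], so the averages at [z] are 1 and 0. *)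
Lemma averaging_op_indic_far (x y : X) (F G : Linfty mu) :
  4 * r < mdist x y ->
  (F : T -> R) = \1_(cball x (2 * r)) %[ae cmu mu] ->
  (G : T -> R) = \1_(cball y (2 * r)) %[ae cmu mu] ->
  1 <= `|averaging_op bX fX r0 F - averaging_op bX fX r0 G|.
Proof.
move=> xy Fx Gy.
have avgE (H : Linfty mu) z w :
    (H : T -> R) = \1_(cball z (2 * r)) %[ae cmu mu] ->
    average mu r H w =
    fine (mu (cball z (2 * r) `&` cball w r)) / fine (mu (cball w r)).
  move=> Hz; rewrite -average_indic//; apply: eq_average => //.
  by apply: measurable_indic; exact: measurable_cball.
have /andP[x0 xoo] := fX x r0.
apply: (Linfty_dist_ge fX (averaging_opE bX fX r0 F)
  (averaging_opE bX fX r0 G) x0) => z /= xz.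
have /andP[z0 zoo] := fX z r0.
rewrite (avgE F x)// (avgE G y)//.
rewrite (_ : cball x (2 * r) `&` cball z r = cball z r); last first.
  apply/setIidPr => w; have := metric_triangle x z w.
  by move: xz; rewrite /cball/=; lra.
rewrite (_ : cball y (2 * r) `&` cball z r = set0); last first.
  apply/seteqP; split => // w [].
  have := metric_triangle x z y; have := metric_triangle z w y.
  by move: xz; rewrite /cball/= (metric_sym w y); lra.
rewrite outer_measure0 mul0r subr0 divff ?normr1//.
by rewrite gt_eqF// fine_gt0// z0.
Qed.

Lemma averaging_op_compact_bounded :
  compact_operator (averaging_op bX fX r0) -> bounded_space X.
Proof.
move=> cA; apply: contrapT => unbX.
have [h hP] : {h : X -> Linfty mu & forall x,
    (h x : T -> R) = \1_(cball x (2 * r)) %[ae cmu mu]}.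
  apply: (@choice _ _ (fun x (F : Linfty mu) =>
    (F : T -> R) = \1_(cball x (2 * r)) %[ae cmu mu])) => x.
  apply: (@bounded_Linfty _ _ _ fX _ 1).
    by apply: measurable_indic; exact: measurable_cball.
  by move=> y; rewrite indicE ger0_norm// lern1 leq_b1.
have [|K AK [cK _]] := cA [set F | `|F| <= 1].
  by exists 1; split => // M M1 F /= F1; exact: le_trans (ltW M1).
(* The filter of points escaping to infinity; it is proper because [X] is unbounded. *)
pose far := filter_from [set: R] (fun t => [set x : X | t < mdist point x]).
have farP : ProperFilter far.
  apply: filter_from_proper => [|t _].
    apply: filter_from_filter; first by exists 0.
    move=> s t _ _; exists (Num.max s t) => // x /=.
    by rewrite gt_max => /andP[].
  apply: contrapT => nt; apply: unbX; exists (2 * t) => x y.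
  have ltt (z : X) : mdist point z <= t.
    by rewrite leNgt; apply/negP => tz; apply: nt; exists z.
  have := metric_triangle x point y; rewrite (metric_sym x point).
  by have := ltt x; have := ltt y; lra.
pose g x := averaging_op bX fX r0 (h x).
have gK : \forall x \near far, K (g x).
  apply: filterE => x; apply: AK; exists (h x) => //=.
  apply/(Linfty_norm_leP fX); apply: filterS (hP x) => y /(_ I) ->.
  by rewrite indicE ger0_norm// lern1 leq_b1.
have [p [_ clp]] := cK (g @ far) _ gK.
(* [p] is a cluster point of the images along [far], so arbitrarily distant points have images
   within [1 / 2] of [p]. *)
have meet t : exists2 x, t < mdist point x & `|p - g x| < 1 / 2.
  have /(clp _ (ball p (1 / 2)))[|_ [[x tx <-]]] :
      (g @ far) (g @` [set x | t < mdist point x]).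
    by exists t => // x tx; exists x.
    by apply: nbhsx_ballx; rewrite divr_gt0.
  by rewrite -ball_normE => px; exists x.
have [x _ px] := meet 0.
(* Choosing [y] after [x] forces [4 * r < mdist x y], while both images are within [1 / 2] of [p],
   hence less than 1 apart. *)
have [y xy py] := meet (mdist point x + 4 * r).
have d4 : 4 * r < mdist x y.
  by have := metric_triangle point x y; lra.
have := averaging_op_indic_far d4 (hP x) (hP y).
rewrite -/(g x) -/(g y) leNgt => /negP; apply.
rewrite -(subrKA p) (le_lt_trans (ler_normD _ _))// distrC.
by rewrite [ltRHS](splitr 1) ltrD.
Qed.

End compactness.

Theorem theorem1p2 (R : realType) (X : pmetricType R)
    (mu : {outer_measure set X -> \bar R}) (r : R)
    (mu_borel : borel_measurable mu)
    (mu_regular : borel_regular mu)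
    (mu_balls : pos_fin_balls mu)
    (r_gt0 : 0 < r)
    (mu_doubling : forall s : R, 0 < s -> doubling mu s)
    (mu_star : star_property mu r) :
  compact_operator (averaging_op mu_borel mu_balls r_gt0) <-> bounded_space X.
Proof.
split=> [|Xb]; first exact: averaging_op_compact_bounded.
exact: averaging_op_compact.
Qed.
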